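(* Let $X_1,\ldots,X_n$ be i.i.d. from $P$ on $\mathbb{R}^d$ satisfying (A1), (A2), (A3) and (A4') (see context). For a fixed point $x$, let $\delta(x)=\min\{\|X_i-x\|: p(X_i)>p(x)\}$ (with $\delta(x)=L$, a fixed positive constant, if no such $X_i$ exists). If $x$ is not a mode of $p$, then $n\,\delta^d(x)$ converges in distribution to an exponential random variable with rate parameter $p(x)\,\tau\,v_d$, where $v_d$ is the volume of the unit ball in $\mathbb{R}^d$. If $x$ is a mode, then $n\,\delta^d(x)\to\infty$.
   Context: (A1) $P$ is supported on a compact set $\mathcal{C}$ with bounded continuous density $p$, $\inf_{x\in\mathcal{C}}p(x)\ge a>0$. (A2) $p$ has bounded continuous first, second and third derivatives. (A3) $p$ is Morse (Hessian nondegenerate at every critical point) with finitely many critical points. A mode is a strict local maximum of $p$; $\mathcal{M}$ is the set of modes. (A4') With $L_x=\{y:p(y)>p(x)\}$ and $\mu$ Lebesgue measure: there exists $\tau\in(0,1)$ such that for every $x\notin\mathcal{M}$, $\lim_{t\to0}\mu(L_x\cap B(x,t))/\mu(B(x,t))=\tau$. *)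

(* Defs.v *)
From HB Require Import structures.
From mathcomp Require Import all_boot all_order all_algebra.
From mathcomp Require Import all_classical all_reals all_analysis.
Set Implicit Arguments. Unset Strict Implicit. Unset Printing Implicit Defensive.
Import Order.TTheory GRing.Theory Num.Theory.
Import numFieldNormedType.Exports.
Local Open Scope classical_set_scope.
Local Open Scope ring_scope.

Section defs.
Variables (R : realType) (d : nat).

Definition Rd := g_sigma_algebraType (@open 'rV[R]_d).

Definition enorm (x : 'rV[R]_d) : R := Num.sqrt (\sum_(i < d) x ord0 i ^+ 2).
Definition eball (x : 'rV[R]_d) (t : R) : set 'rV[R]_d :=
  [set y | enorm (y - x) < t].

(* Lebesgue measure on R^d: a measure on the Borel sets giving every closed
   box its volume (this characterizes Lebesgue measure on Borel sets). *)
Definition is_lebesgue (leb : set Rd -> \bar R) : Prop :=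
  forall a b : 'rV[R]_d, (forall i, a ord0 i <= b ord0 i) ->
    leb ([set x : 'rV[R]_d | forall i, a ord0 i <= x ord0 i <= b ord0 i] : set Rd)
    = (\prod_(i < d) (b ord0 i - a ord0 i))%:E.

Definition vol_ball (leb : set Rd -> \bar R) : R := fine (leb (eball 0 1 : set Rd)).

Definition ecoord (i : 'I_d) : 'rV[R]_d := delta_mx ord0 i.
Definition pd (i : 'I_d) (f : 'rV[R]_d -> R) : 'rV[R]_d -> R :=
  fun x => 'D_(ecoord i) f x.

Definition bounded_on (f : 'rV[R]_d -> R) (U : set 'rV[R]_d) :=
  exists M : R, forall x, U x -> `|f x| <= M.

Definition C3_bounded_on (f : 'rV[R]_d -> R) (U : set 'rV[R]_d) : Prop :=
  forall i j k : 'I_d,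
    (forall x, U x ->
       [/\ derivable f x (ecoord i), derivable (pd i f) x (ecoord j)
         & derivable (pd j (pd i f)) x (ecoord k)]) /\
    ({within U, continuous (pd i f)} /\
     {within U, continuous (pd j (pd i f))} /\
     {within U, continuous (pd k (pd j (pd i f)))} /\
     bounded_on (pd i f) U /\ bounded_on (pd j (pd i f)) U /\
     bounded_on (pd k (pd j (pd i f))) U).

Definition critical (f : 'rV[R]_d -> R) (U : set 'rV[R]_d) (x : 'rV[R]_d) :=
  U x /\ forall i, pd i f x = 0.
Definition hessian (f : 'rV[R]_d -> R) (x : 'rV[R]_d) : 'M[R]_d :=
  \matrix_(i, j) pd j (pd i f) x.

Definition morse_on (f : 'rV[R]_d -> R) (U : set 'rV[R]_d) : Prop :=
  finite_set (critical f U) /\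
  forall x, critical f U x -> \det (hessian f x) != 0.

Definition is_mode (f : 'rV[R]_d -> R) (x : 'rV[R]_d) : Prop :=
  \forall y \near x, y != x -> f y < f x.

Definition upper_set (f : 'rV[R]_d -> R) (x : 'rV[R]_d) : set 'rV[R]_d :=
  [set y | f x < f y].

Definition delta {T : Type} (f : 'rV[R]_d -> R) (L : R) (X : nat -> T -> 'rV[R]_d)
  (n : nat) (x : 'rV[R]_d) (w : T) : R :=
  if [exists i : 'I_n, f x < f (X i w)]
  then fine (\big[Order.min/+oo%E]_(i < n | f x < f (X i w)) (enorm (X i w - x))%:E)
  else L.

End defs.

Definition mutually_independent {dT} {T : measurableType dT} {R : realType} {d : nat}
  (P : probability T R) (X : nat -> T -> Rd R d) : Prop :=
  forall (s : seq nat) (B : nat -> set (Rd R d)), uniq s ->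
    (forall i, measurable (B i)) ->
    P (\big[setI/setT]_(i <- s) (X i @^-1` B i)) =
    (\prod_(i <- s) P (X i @^-1` B i))%E.

(* convergence in distribution of real random variables Y_n to the law mu:
   P(Y_n <= t) -> mu(]-oo, t]) at every continuity point t of the limit cdf *)
Definition cvg_in_distribution {dT} {T : measurableType dT} {R : realType}
  (P : probability T R) (Y : nat -> T -> R) (mu : set R -> \bar R) : Prop :=
  forall t : R, mu [set t] = 0%E ->
    (fun n => P [set w | Y n w <= t]) @ \oo --> mu `]-oo, t]%classic.

(* Main.v *)
(* For 0 < s < L, delta(x) > s means that none of the first n sample points lies
   in A_s, the part of the closed ball B(x, s) where p exceeds p(x); this has
   probability (1 - q_s)^n with q_s the integral of p over A_s. On A_s the
   density p is at least p(x) and, by continuity on C (p vanishes off C, so A_s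
   lies in C), at most p(x) + o(1); hence q_s ~ p(x) leb(A_s) ~ p(x) tau v_d s^d
   by (A4'). With s = (t/n)^(1/d) this gives n q_s -> p(x) tau v_d t, and
   (1 - q_s)^n -> exp(- p(x) tau v_d t). At a mode no point near x has a larger
   density, so delta(x) is bounded below by a positive constant. *)

Require Import Defs.
From HB Require Import structures.
From mathcomp Require Import all_boot all_order all_algebra.
From mathcomp Require Import all_classical all_reals all_analysis.
From mathcomp Require Import measurable_realfun ring.
Import Order.TTheory GRing.Theory Num.Theory.
Import numFieldNormedType.Exports.
Local Open Scope classical_set_scope.
Local Open Scope ring_scope.

Set Implicit Arguments. Unset Strict Implicit. Unset Printing Implicit Defensive.

(** * Euclidean balls, boxes and the Borel sets they generate *)

Section EuclideanNorm.
Variables (R : realType) (d : nat).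
Implicit Types (x y : 'rV[R]_d) (t : R).

Lemma enorm_ge0 x : 0 <= enorm x.
Proof. exact: sqrtr_ge0. Qed.

Lemma coord_le_enorm x i : `|x ord0 i| <= enorm x.
Proof.
rewrite -sqrtr_sqr ler_sqrt ?sumr_ge0// => [|j _]; last exact: sqr_ge0.
by rewrite (bigD1 i)//= lerDl sumr_ge0// => j _; exact: sqr_ge0.
Qed.

Lemma enorm_eq0 x : enorm x = 0 -> x = 0.
Proof.
move=> x0; apply/rowP => i; rewrite mxE.
by apply/eqP; rewrite -normr_le0 -x0 coord_le_enorm.
Qed.

Lemma enormZ t x : enorm (t *: x) = `|t| * enorm x.
Proof.
rewrite /enorm -sqrtr_sqr -sqrtrM ?sqr_ge0// mulr_sumr.
by congr Num.sqrt; apply: eq_bigr => i _; rewrite mxE exprMn.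
Qed.

Lemma continuous_enormB x : continuous (fun y => enorm (y - x)).
Proof.
have sum_cont : continuous (fun y => \sum_(i < d) (y - x) ord0 i ^+ 2).
  apply: continuous_big => [|i _ y]; first exact: add_continuous.
  under eq_fun do rewrite !mxE.
  apply: (@continuous_comp _ _ _ (fun z : 'rV[R]_d => z ord0 i)
    (fun u => (u - x ord0 i) ^+ 2)); first exact: coord_continuous.
  apply: (@continuous_comp _ _ _ (fun u => u - x ord0 i) (fun u => u ^+ 2)).
    by apply: cvgB; [exact: cvg_id|exact: cvg_cst].
  exact: exprn_continuous.
move=> y; apply: (@continuous_comp _ _ _ _ (@Num.sqrt R)).
  exact: sum_cont.
exact: sqrt_continuous.
Qed.

(** Closed balls match events of the form [delta <= s], whereas (A4') is stated with open balls;
    [leb_setI_cball] connects the two. *)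
Definition cball x t : set 'rV[R]_d := [set y | enorm (y - x) <= t].

Lemma open_eball x t : open (eball x t).
Proof.
have /continuousP/(_ _ (@open_lt _ t)) := @continuous_enormB x.
by [].
Qed.

Lemma measurable_eball x t : measurable (eball x t : set (Rd R d)).
Proof. by apply: sub_sigma_algebra; exact: open_eball. Qed.

Lemma measurable_cball x t : measurable (cball x t : set (Rd R d)).
Proof.
rewrite -[cball x t]setCK; apply: measurableC; apply: sub_sigma_algebra.
rewrite (_ : ~` _ = [set y | t < enorm (y - x)]).
  by have /continuousP/(_ _ (@open_gt _ t)) := @continuous_enormB x.
by apply/seteqP; split => y /=; rewrite ltNge => /negP.
Qed.

(** The corners need not be ordered: an out-of-order pair gives the empty set, which lets [boxes] be
    closed under intersection. *)
Definition box (a b : 'rV[R]_d) : set 'rV[R]_d :=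
  [set x | forall i, a ord0 i <= x ord0 i <= b ord0 i].
Definition boxes : set (set 'rV[R]_d) := [set box a b | a in setT & b in setT].

Lemma closed_box a b : closed (box a b).
Proof.
rewrite (_ : box a b = \bigcap_i [set x | a ord0 i <= x ord0 i <= b ord0 i]); last first.
  by apply/seteqP; split => [x h i _|x h i]; exact: h.
apply: closed_bigI => i _.
rewrite [X in closed X](_ : _ = (fun x : 'rV[R]_d => x ord0 i) @^-1` `[a ord0 i, b ord0 i]%classic).
  apply: closed_comp; last exact: itv_closed.
  by move=> x _; exact: coord_continuous.
by apply/seteqP; split => x /=; rewrite in_itv.
Qed.

Lemma setI_closed_boxes : setI_closed boxes.
Proof.
move=> _ _ [a _ [b _ <-]] [a' _ [b' _ <-]].
exists (\row_i Num.max (a ord0 i) (a' ord0 i)) => //.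
exists (\row_i Num.min (b ord0 i) (b' ord0 i)) => //.
apply/seteqP; split => x /=.
  move=> h; split => i; have := h i; rewrite !mxE ge_max le_min;
    by move=> /andP[/andP[? ?] /andP[? ?]]; apply/andP.
move=> [h h'] i; rewrite !mxE ge_max le_min.
by have /andP[-> ->] := h i; have /andP[-> ->] := h' i.
Qed.

(** An open set is the countable union of the rational boxes it contains, and conversely each box is
    closed. This makes the boxes a generating pi-system for the uniqueness of measures. *)
Lemma measurable_rV_boxes :
  measurable = <<s boxes >> :> set (set (Rd R d)).
Proof.
apply/seteqP; split.
- apply: smallest_sub; first exact: smallest_sigma_algebra.
  move=> U oU.
  (* Boxes that leave [U] are replaced by the empty set, so the union runs over the whole countable
     type of rational corner pairs. *)
  pose F (ab : 'rV[rat]_d * 'rV[rat]_d) : set 'rV[R]_d :=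
    let B := box (map_mx ratr ab.1) (map_mx ratr ab.2) in
    if `[< B `<=` U >] then B else set0.
  rewrite (_ : U = \bigcup_ab F ab).
    apply: (@countable_bigcupT_measurable _ (g_sigma_algebraType boxes) _ F).
      exact: countableP.
    move=> ab; rewrite /F; case: ifPn => _; last exact: measurable0.
    by apply: sub_sigma_algebra; exists (map_mx ratr ab.1) => //; exists (map_mx ratr ab.2).
  apply/seteqP; split => [x Ux|x [ab _]]; last first.
    by rewrite /F; case: asboolP => // + Fx; exact.
  have /nbhs_ballP[e /= e0 xeU] : nbhs x U by exact: open_nbhs_nbhs.
  have /choice[a ha] : forall i, exists q : rat, ratr q \in `]x ord0 i - e, x ord0 i[.
    by move=> i; apply: rat_in_itvoo; rewrite ltrBlDr ltrDl.
  have /choice[b hb] : forall i, exists q : rat, ratr q \in `]x ord0 i, x ord0 i + e[.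
    by move=> i; apply: rat_in_itvoo; rewrite ltrDl.
  exists (\row_i a i, \row_i b i) => //; rewrite /F ifT /=.
    move=> i; rewrite !mxE; have := ha i; have := hb i.
    by rewrite !in_itv/= => /andP[/ltW -> _] /andP[_ /ltW ->].
  (* The library ball is taken coordinatewise, so corners within [e] of [x] in each coordinate keep
     the box inside it. *)
  apply/asboolP => y yab; apply: xeU => /=.
  split => // k i; rewrite ord1 /ball /=.
  have := yab i; have := ha i; have := hb i.
  rewrite !in_itv/= !mxE => /andP[_ bx] /andP[xa _] /andP[ay yb].
  by rewrite distrC ltr_distl (lt_le_trans xa ay) (le_lt_trans yb bx).
- apply: smallest_sub; first exact: sigma_algebra_measurable.
  move=> _ [a _ [b _ <-]].
  rewrite -[box a b]setCK; apply: measurableC; apply: sub_sigma_algebra.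
  by apply: closed_openC; exact: closed_box.
Qed.

(** The topology comes from the sup norm; since it is dominated by [enorm], a Euclidean ball fits in
    the sup-norm ball of the same radius. *)
Lemma nbhs_eball x (A : set 'rV[R]_d) : nbhs x A ->
  exists2 e : R, 0 < e & eball x e `<=` A.
Proof.
move=> /nbhs_ballP[e /= e0 xeA]; exists e => // y xy; apply: xeA.
split => // k i; rewrite ord1 /ball /= distrC (le_lt_trans _ xy)//.
by have := coord_le_enorm (y - x) i; rewrite !mxE.
Qed.

End EuclideanNorm.

(** * Uniqueness and scaling of Lebesgue measure *)

Section LebesgueScaling.
Variables (R : realType) (d : nat) (leb : {measure set (Rd R d) -> \bar R}).
Hypothesis hleb : is_lebesgue leb.
Implicit Types (x : 'rV[R]_d) (t : R).

Let leb_box (a b : 'rV[R]_d) : (forall i, a ord0 i <= b ord0 i) ->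
  leb (box a b : set (Rd R d)) = (\prod_(i < d) (b ord0 i - a ord0 i))%:E.
Proof. exact: hleb. Qed.

Lemma eball_sub_box x t : eball x t `<=` box (\row_i (x ord0 i - t)) (\row_i (x ord0 i + t)).
Proof.
move=> y xy i; rewrite !mxE -ler_distl.
have := coord_le_enorm (y - x) i; rewrite !mxE => /le_trans; apply.
exact: ltW.
Qed.

Lemma measurable_box (a b : 'rV[R]_d) : measurable (box a b : set (Rd R d)).
Proof.
by rewrite measurable_rV_boxes; apply: sub_sigma_algebra; exists a => //; exists b.
Qed.

Lemma leb_eball_lty x t : 0 < t -> (leb (eball x t) < +oo)%E.
Proof.
move=> t0; apply: (@le_lt_trans _ _
    (leb (box (\row_i (x ord0 i - t)) (\row_i (x ord0 i + t))))).
  apply: le_measure; rewrite ?inE; last exact: eball_sub_box.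
    exact: measurable_eball.
  exact: measurable_box.
rewrite leb_box ?ltry// => i; rewrite !mxE.
by rewrite lerBlDr -addrA lerDl addr_ge0// ltW.
Qed.

(** Both measures agree on the pi-system of boxes, and the cubes of half-side [n] exhaust the space
    with finite measure. *)
Lemma is_lebesgue_unique (mu : {measure set (Rd R d) -> \bar R}) :
  is_lebesgue mu -> forall A, measurable A -> leb A = mu A.
Proof.
move=> hmu; apply: (@measure_unique _ R (Rd R d) (@boxes R d)
  (fun n => box (const_mx (- n%:R)) (const_mx n%:R))).
- exact: measurable_rV_boxes.
- exact: setI_closed_boxes.
- by move=> n; exists (const_mx (- n%:R)) => //; exists (const_mx n%:R).
- rewrite -subTset => x _; exists (Num.truncn (enorm x)).+1 => // i.
  rewrite !mxE -ler_norml (le_trans (coord_le_enorm _ _))// ltW//.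
  exact: Num.Theory.truncnS_gt.
- move=> _ [a _ [b _ <-]].
  (* [is_lebesgue] covers ordered corners only; otherwise the box is empty. *)
  have [ab|/existsNP[i abi]] := pselect (forall i, a ord0 i <= b ord0 i).
    by rewrite leb_box//; exact/esym/hmu.
  rewrite (_ : box a b = set0) ?measure0//.
  by rewrite -subset0 => x /(_ i)/andP[/le_trans h /h].
- by move=> n; rewrite leb_box ?ltry// => i; rewrite !mxE (@le_trans _ _ 0) ?oppr_le0.
Qed.

Lemma measurable_affine x t :
  measurable_fun [set: Rd R d] (fun y => x + t *: y : Rd R d).
Proof.
apply: (@measurability _ _ (Rd R d) (Rd R d) setT _ (@open 'rV[R]_d)) => //.
have cont : continuous (fun y : 'rV[R]_d => x + t *: y).
  move=> y; apply: continuousD; first exact: cst_continuous.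
  by apply: continuousZr => z; exact: cvg_id.
move=> _ [U oU <-]; rewrite setTI; apply: sub_sigma_algebra.
by apply: open_comp oU => y _; exact: cont.
Qed.

(** The right-hand side is a measure in [A]: a pushforward scaled by [t ^+ d]. The preimage of a box
    has its sides divided by [t], so this measure gives boxes their volume, and uniqueness
    applies. *)
Lemma leb_affine x t A : 0 < t -> measurable (A : set (Rd R d)) ->
  leb A = ((t ^+ d)%:E * leb ((fun y => (x + t *: y)%R : Rd R d) @^-1` A))%E.
Proof.
move=> t0 mA.
have t0' : (0 <= t ^+ d)%R by rewrite exprn_ge0// ltW.
pose mu := mscale (NngNum t0')
  (measure_function_pushforward__canonical__measure_function_Measure leb
     (@measurable_affine x t)).
rewrite [LHS](@is_lebesgue_unique mu)// => a b ab.
rewrite /mu /= /mscale /= /pushforward.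
rewrite (_ : _ @^-1` _ = box (t^-1 *: (a - x)) (t^-1 *: (b - x))); last first.
  apply/seteqP; split => y h i; have := h i; rewrite !mxE;
    by rewrite ler_pdivrMl// ler_pdivlMl// lerBlDl lerBrDl.
rewrite leb_box => [|i]; last by rewrite !mxE ler_pM2l ?invr_gt0// lerB.
rewrite -EFinM -[X in t ^+ X]card_ord -prodr_const -big_split/=.
congr EFin; apply: eq_bigr => i _; rewrite !mxE.
by rewrite -mulrBr opprB addrA subrK mulrA divff ?mul1r// gt_eqF.
Qed.

Lemma leb_eball x t : 0 < t ->
  leb (eball x t) = ((t ^+ d)%:E * leb (eball 0 1 : set (Rd R d)))%E.
Proof.
move=> t0; rewrite (@leb_affine x t)//; last exact: measurable_eball.
congr (_ * leb _)%E; apply/seteqP; split => y; rewrite /eball /= subr0 addrAC subrr add0r;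
  by rewrite enormZ gtr0_norm// gtr_pMr.
Qed.

Lemma fine_leb_eball x t : 0 < t ->
  fine (leb (eball x t : set (Rd R d))) = t ^+ d * vol_ball leb.
Proof.
move=> t0; rewrite leb_eball// fineM// ge0_fin_numE//; exact: leb_eball_lty.
Qed.

(* The closed ball is squeezed between open balls of radii tending to [t]. *)
Lemma leb_cball x t : 0 < t -> leb (cball x t) = leb (eball x t).
Proof.
move=> t0; apply/eqP; rewrite eq_le; apply/andP; split; last first.
  apply: le_measure; rewrite ?inE; [exact: measurable_eball|exact: measurable_cball|].
  by move=> y /ltW.
have c_fin : leb (cball x t) \is a fin_num.
  rewrite ge0_fin_numE//; apply: le_lt_trans (leb_eball_lty x (ltr_pwDr ltr01 (ltW t0))).
  apply: le_measure; rewrite ?inE; [exact: measurable_cball|exact: measurable_eball|].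
  by move=> y /le_lt_trans; apply; rewrite ltrDl.
have e_fin s : 0 < s -> leb (eball x s) \is a fin_num.
  by move=> s0; rewrite ge0_fin_numE//; exact: leb_eball_lty.
rewrite -(fineK c_fin) -(fineK (e_fin _ t0)) lee_fin fine_leb_eball//.
apply: (@closed_cvg _ _ t^'+ _ (fun s => s ^+ d * vol_ball leb)
  (fun r => fine (leb (cball x t)) <= r)).
- exact: closed_ge.
- near=> s.
  have s0 : 0 < s by exact: lt_trans (t0) _.
  rewrite -(@fine_leb_eball x)// fine_le ?e_fin//.
  apply: le_measure; rewrite ?inE; [exact: measurable_cball|exact: measurable_eball|].
  by move=> y /le_lt_trans; apply.
- apply: cvg_at_right_filter; apply: cvgMl; exact: exprn_continuous.
Unshelve. all: by end_near. Qed.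

(** The two sets differ only within the sphere, which is null because the closed and open balls have
    equal finite measure. *)
Lemma leb_setI_cball x t A : 0 < t -> measurable (A : set (Rd R d)) ->
  leb (A `&` cball x t) = leb (A `&` eball x t).
Proof.
move=> t0 mA.
have mE := measurable_eball x t; have mB := measurable_cball x t.
have EB : eball x t `<=` cball x t by move=> y /ltW.
have e_fin : leb (eball x t) \is a fin_num.
  by rewrite ge0_fin_numE//; exact: leb_eball_lty.
have sphere0 : leb (cball x t `\` eball x t) = 0%E.
  rewrite measureD//; last by rewrite [ltLHS]leb_cball//; exact: leb_eball_lty.
  by rewrite (setIidr EB) [X in (X - _)%E]leb_cball// subee.
have mI : measurable (A `&` eball x t) by exact: measurableI.
have mD : measurable (A `&` (cball x t `\` eball x t)).
  by apply: measurableI => //; exact: measurableD.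
rewrite -{1}(setDUK EB) setIUr measureU//; last first.
  by apply/seteqP; split => // y [[_ ?] [_ [_]]].
rewrite [X in (_ + X)%E](_ : _ = 0%E) ?adde0//.
apply/eqP; rewrite eq_le measure_ge0 andbT -sphere0.
by apply: le_measure; rewrite ?inE//; exact: measurableD.
Qed.

End LebesgueScaling.

(** * Limit of (1 - u)^n and the exponential distribution function *)

Section ExponentialLimits.
Variable R : realType.

(** For [0 <= u < 1], exp(- u / (1 - u)) <= 1 - u <= exp(- u). The n-th powers of both bounds tend
    to [expR (- l)], since [u n] tends to 0. *)
Lemma cvg_exp1B (u : nat -> R) (l : R) : (forall n, 0 <= u n) ->
  n%:R * u n @[n --> \oo] --> l ->
  (1 - u n) ^+ n @[n --> \oo] --> expR (- l).
Proof.
move=> u0 nul.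
have u_cvg0 : u n @[n --> \oo] --> (0 : R).
  rewrite -(mul0r l).
  have : n%:R^-1 * (n%:R * u n) @[n --> \oo] --> 0 * l.
    apply: cvgM nul.
    by apply/gtr0_cvgV0; [near=> n; rewrite ltr0n; near: n; exact: nbhs_infty_gt|exact: cvgr_idn].
  apply: cvg_trans; apply: near_eq_cvg; near=> n.
  rewrite mulKf// pnatr_eq0 -lt0n; near: n; exact: nbhs_infty_gt.
apply: (@squeeze_cvgr _ _ _ _ (fun n => expR (- (n%:R * u n / (1 - u n))))
  (fun n => expR (- (n%:R * u n)))).
- near=> n.
  have u1 : 0 < 1 - u n.
    rewrite subr_gt0; near: n; apply: cvgr_lt u_cvg0 _ _; exact: ltr01.
  apply/andP; split; last first.
    rewrite -mulrN expRM_natl lerXn2r ?nnegrE ?expR_ge0 ?(ltW u1)//.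
    exact: expR_ge1Dx.
  rewrite -mulrA -mulrN expRM_natl lerXn2r ?nnegrE ?expR_ge0 ?(ltW u1)//.
  rewrite expRN invf_ple ?posrE ?expR_gt0//.
  (* The lower bound is 1 + y <= exp y at y = u / (1 - u), where 1 + y is the inverse of 1 - u. *)
  rewrite [leLHS](_ : _ = 1 + u n / (1 - u n)) ?expR_ge1Dx//.
  by rewrite -[X in _ = X + _](@divff _ (1 - u n)) ?gt_eqF// -mulrDl subrK mul1r.
- apply: continuous_cvg; first exact: continuous_expR.
  apply: cvgN; rewrite -[X in _ --> X]mulr1 -[X in _ * X]invr1.
  apply: cvgM nul _; apply: cvgV; first exact: oner_neq0.
  by rewrite -[X in _ --> X]subr0; apply: cvgB => //; exact: cvg_cst.
- apply: continuous_cvg; first exact: continuous_expR.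
  exact: cvgN.
Unshelve. all: by end_near. Qed.

Lemma exponential_prob_ltNy0 (r : R) : exponential_prob r `]-oo, 0[ = 0%E.
Proof.
rewrite /exponential_prob; apply: integral0_eq => y /=.
by rewrite in_itv/= => y0; rewrite lt0_exponential_pdf.
Qed.

Lemma exponential_prob_Nyc (r t : R) : 0 <= r -> 0 < t ->
  exponential_prob r `]-oo, t] = (1 - expR (- r * t))%:E.
Proof.
move=> r0 t0.
rewrite (@itv_bndbnd_setU _ _ -oo%O (BLeft 0)) ?bnd_simp ?ltW//.
rewrite {1}/exponential_prob ge0_integral_setU//=.
- by rewrite -!/(exponential_prob r _) exponential_prob_ltNy0 add0e exponential_prob_itv0c.
- apply/measurable_EFinP; apply: measurable_funTS; exact: measurable_exponential_pdf.
- by move=> y _; rewrite lee_fin exponential_pdf_ge0.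
- by apply/disj_setPLR => y /=; rewrite !in_itv/= => y0 /andP[]; rewrite leNgt y0.
Qed.

(** The density vanishes strictly below [t], and the point [t] itself is handled by the no-atom
    hypothesis, which convergence in distribution provides. *)
Lemma exponential_prob_Nyc_le0 (r t : R) : 0 <= r -> t <= 0 ->
  exponential_prob r [set t] = 0%E -> exponential_prob r `]-oo, t] = 0%E.
Proof.
move=> r0 t0 rt.
rewrite (@itv_bndbnd_setU _ _ -oo%O (BLeft t)) ?bnd_simp// set_itv1.
rewrite {1}/exponential_prob ge0_integral_setU//=.
- rewrite -!/(exponential_prob r _) rt adde0; apply: integral0_eq => y /=.
  by rewrite in_itv/= => yt; rewrite lt0_exponential_pdf// (lt_le_trans yt).
- apply/measurable_EFinP; apply: measurable_funTS; exact: measurable_exponential_pdf.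
- by move=> y _; rewrite lee_fin exponential_pdf_ge0.
- by apply/disj_setPLR => y /=; rewrite !in_itv/= => + yt; rewrite yt ltxx.
Qed.

End ExponentialLimits.

(** * Distance to the nearest sample point of higher density *)

Section NearestHigherPoint.
Variables (R : realType) (d : nat) (T : Type) (p : 'rV[R]_d -> R) (L : R).
Variables (X : nat -> T -> 'rV[R]_d) (x : 'rV[R]_d).
Hypothesis L_gt0 : 0 < L.

(* [s < L] discards the default value of [delta]. *)
Lemma delta_leP n w s : s < L ->
  delta p L X n x w <= s <->
  exists2 i : 'I_n, p x < p (X i w) & enorm (X i w - x) <= s.
Proof.
move=> sL; rewrite /delta; case: ifPn => [/existsP[j pj]|/existsPn np]; last first.
  split=> [/(lt_le_trans sL)|[i + _]]; first by rewrite ltxx.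
  by rewrite (negbTE (np i)).
set m := \big[_/_]_(i < n | _) _.
have m_fin : m \is a fin_num.
  rewrite ge0_fin_numE; first exact: le_lt_trans (bigmin_le_cond _ _ pj) (ltry _).
  by apply: le_bigmin => // i _; rewrite lee_fin enorm_ge0.
rewrite -lee_fin fineK//; split => [/bigmin_leP[//|[i pi +]]|[i pi ns]].
  by rewrite lee_fin; exists i.
by apply/bigmin_leP; right; exists i.
Qed.

Lemma delta_ge n w r :
  (forall y, eball x r y -> ~ p x < p y) -> Num.min r L <= delta p L X n x w.
Proof.
move=> pr; rewrite leNgt lt_min; apply/negP => /andP[dr dL].
(* Taking [s] to be [delta] itself produces a higher sample point at distance at most [delta]. *)
have /(delta_leP _ _ dL)[i pi xi] := lexx (delta p L X n x w).
exact: pr (le_lt_trans xi dr) pi.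
Qed.

(** A value of at most 0 would put a sample point at [x] itself, whose density is not above
    [p x]. *)
Lemma delta_gt0 n w : 0 < delta p L X n x w.
Proof.
rewrite ltNge; apply/negP => /(delta_leP _ _ L_gt0)[i + xi].
suff -> : X i w = x by rewrite ltxx.
by apply/subr0_eq/enorm_eq0/eqP; rewrite eq_le xi enorm_ge0.
Qed.

(** Turns the event for the rescaled variable into one about the radius (t / n)^(1/d), by
    monotonicity of the d-th power on nonnegative reals. *)
Lemma natM_delta_le n w t : (0 < d)%N -> (0 < n)%N -> 0 <= t ->
  (n%:R * delta p L X n x w ^+ d <= t) =
  (delta p L X n x w <= (t / n%:R) `^ d%:R^-1).
Proof.
move=> d0 n0 t0.
rewrite mulrC -ler_pdivlMr ?ltr0n// -[X in _ <= X]powRr1 ?divr_ge0//.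
rewrite -[X in _ `^ X](@mulVf _ d%:R) ?pnatr_eq0 -?lt0n// powRrM.
by rewrite powR_mulrn ?powR_ge0// ler_pXn2r ?nnegrE ?powR_ge0// ltW// delta_gt0.
Qed.

End NearestHigherPoint.

(** * Hitting probability of an i.i.d. sample *)

Section IidSample.
Variables (R : realType) (d : nat) (dT : measure_display) (T : measurableType dT).
Variables (P : probability T R) (X : nat -> T -> Rd R d).
Hypothesis hXmeas : forall i, measurable_fun setT (X i).
Hypothesis hind : mutually_independent P X.

(** The complementary event is that all [n] points miss [A]; by independence it has probability (1 -
    q)^n. *)
Lemma prob_some_in (A : set (Rd R d)) (q : R) n : measurable A ->
  (forall i, P (X i @^-1` A) = q%:E) ->
  P [set w | exists i : 'I_n, A (X i w)] = (1 - (1 - q) ^+ n)%:E.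
Proof.
move=> mA hq.
have mX i (B : set (Rd R d)) : measurable B -> measurable (X i @^-1` B).
  by move=> mB; rewrite -[X in measurable X]setTI; exact: hXmeas.
rewrite [X in P X](_ : _ = ~` \big[setI/setT]_(i <- iota 0 n) (X i @^-1` (~` A))); last first.
  apply/seteqP; split => w /=.
    move=> [i Ai]; rewrite -bigcap_seq => /(_ i); apply => //=.
    by rewrite mem_iota add0n ltn_ord.
  rewrite -bigcap_seq => /existsNP[i /not_implyP[]] /=.
  by rewrite mem_iota add0n => /= lt_in /contrapT Ai; exists (Ordinal lt_in).
rewrite probability_setC; last first.
  by apply: bigsetI_measurable => i _; apply: mX; exact: measurableC.
rewrite (hind (iota_uniq _ _) (B := fun=> ~` A)); last by move=> _; exact: measurableC.
rewrite (eq_bigr (fun=> (1 - q)%:E)); last first.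
  move=> i _; rewrite preimage_setC probability_setC; last exact: mX.
  by rewrite [X in (1 - X)%E]hq -EFinB.
by rewrite prodEFin big_const_seq count_predT size_iota iter_mulr_1.

Qed.

End IidSample.

(** * Mass of the higher-density part of a small ball *)

Section MassAboveLevel.
Variables (R : realType) (d : nat) (leb : {measure set (Rd R d) -> \bar R}).
Hypothesis hleb : is_lebesgue leb.
Variables (p : 'rV[R]_d -> R) (C : set 'rV[R]_d) (x : 'rV[R]_d).
Hypothesis hpmeas : measurable_fun setT (p : Rd R d -> R).
Hypothesis hsupp : forall y, ~ C y -> p y = 0.
Hypothesis hpcont : {within C, continuous p}.
Hypothesis hx : C x.
Hypothesis px_ge0 : 0 <= p x.

Definition upper_cball s : set (Rd R d) := upper_set p x `&` cball x s.

Lemma measurable_upper_set : measurable (upper_set p x : set (Rd R d)).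
Proof.
rewrite (_ : upper_set p x = setT `&` p @^-1` `]p x, +oo[%classic).
  by apply: hpmeas => //; exact: measurable_itv.
by rewrite setTI; apply/seteqP; split => y /=; rewrite in_itv/= andbT.
Qed.

Lemma measurable_upper_cball s : measurable (upper_cball s).
Proof.
by apply: measurableI; [exact: measurable_upper_set|exact: measurable_cball].
Qed.

Lemma leb_upper_cball_le s : 0 < s ->
  (leb (upper_cball s) <= leb (eball x s : set (Rd R d)))%E.
Proof.
move=> s0; rewrite -leb_cball//; apply: le_measure; rewrite ?inE.
- exact: measurable_upper_cball.
- exact: measurable_cball.
- by move=> y [].
Qed.

Lemma leb_upper_cball_fin s : 0 < s -> leb (upper_cball s) \is a fin_num.
Proof.
move=> s0; rewrite ge0_fin_numE//.
exact: le_lt_trans (leb_upper_cball_le s0) (leb_eball_lty hleb x s0).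
Qed.

Lemma integral_upper_cball_ge s :
  ((p x)%:E * leb (upper_cball s) <= \int[leb]_(y in upper_cball s) (p y)%:E)%E.
Proof.
have mA := measurable_upper_cball s.
rewrite -integral_cst//; apply: ge0_le_integral => //.
- by apply/measurable_EFinP; exact: measurable_funTS.
- by move=> y [/ltW + _]; rewrite lee_fin.
Qed.

(** Continuity of [p] at [x] bounds the integrand by [p x + eps] on small balls. *)
Lemma integral_upper_cball_le eps : 0 < eps -> \forall s \near 0^'+,
  (\int[leb]_(y in upper_cball s) (p y)%:E <= (p x + eps)%:E * leb (upper_cball s))%E.
Proof.
move=> eps0.
have /subspace_continuousP/(_ x hx) := hpcont.
move=> /cvgr_lt/(_ (p x + eps)); rewrite ltrDl => /(_ eps0) px.
have [e e0 he] := nbhs_eball px.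
near=> s.
have mA := measurable_upper_cball s.
rewrite -integral_cst//; apply: ge0_le_integral => //.
- by move=> y [/ltW + _]; rewrite lee_fin; exact: le_trans.
- by apply/measurable_EFinP; exact: measurable_funTS.
- move=> y [xy ys]; rewrite lee_fin ltW//; apply: he.
    by apply: le_lt_trans ys _; near: s; exact: nbhs_right_lt.
  (* Continuity is only relative to [C], so [y] must lie in [C]: outside, [p y = 0] could not exceed
     [p x >= 0]. *)
  apply: contrapT => /hsupp py0; move: xy.
  by rewrite /upper_set/= py0 ltNge px_ge0.
Unshelve. all: by end_near. Qed.

Variables (tau t : R) (s : nat -> R).
Hypothesis d0 : (0 < d)%N.
Hypothesis htau :
  (fun t : R => fine (leb (upper_set p x `&` eball x t : set (Rd R d)))
     / fine (leb (eball x t : set (Rd R d)))) r @[r --> 0^'+] --> tau.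
Hypothesis t0 : 0 < t.
Hypothesis s0 : forall n, (0 < n)%N -> 0 < s n.
Hypothesis hs : forall n, (0 < n)%N -> n%:R * s n ^+ d = t.

(** Convergence to the filter [0^'+], not just to 0, lets (A4') and the bounds for small radii be
    composed with [s]. The index 0 is excluded in the hypotheses, since there the radius equation
    would read 0 = t. *)
Lemma cvg_radius : s n @[n --> \oo] --> 0^'+.
Proof.
move=> A [e /= e0 eA].
suff : \forall n \near \oo, A (s n) by [].
near=> n; have n0 : (0 < n)%N by near: n; exact: nbhs_infty_gt.
apply: eA => /=; last exact: s0.
rewrite sub0r normrN gtr0_norm ?s0//.
(* After taking d-th powers and multiplying by [n], the inequality [s n < e] becomes
   [t / e ^+ d < n]. *)
rewrite -(@ltr_pXn2r _ d) ?nnegrE ?(ltW (s0 n0)) ?(ltW e0)//.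
rewrite -(@ltr_pM2l _ n%:R) ?ltr0n// hs// -ltr_pdivrMr ?exprn_gt0//.
near: n; exact: nbhs_infty_gtr.
Unshelve. all: by end_near. Qed.

(** The quantity is the ratio of (A4') times [n] times the ball volume, and the latter product is
    [t * vol_ball leb] because [n * s n ^ d = t]. *)
Lemma cvg_leb_upper_cball :
  n%:R * fine (leb (upper_cball (s n))) @[n --> \oo] --> tau * (t * vol_ball leb).
Proof.
have ratio := cvg_comp _ _ cvg_radius htau.
apply: (cvg_trans _ (cvgM ratio (cvg_cst (t * vol_ball leb)))).
apply: near_eq_cvg; near=> n.
have n0 : (0 < n)%N by near: n; exact: nbhs_infty_gt.
have sn := s0 n0.
rewrite /upper_cball /= leb_setI_cball//; last exact: measurable_upper_set.
set m := fine _.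
(* If the ball had volume 0, so would its upper part, and both sides would be 0; otherwise the
   division cancels. *)
have [b0|b0] := eqVneq (fine (leb (eball x (s n)))) 0.
  have -> : m = 0.
    apply/eqP; rewrite eq_le fine_ge0 ?measure_ge0// andbT -b0.
    rewrite /m -leb_setI_cball//; last exact: measurable_upper_set.
    apply: fine_le; [exact: leb_upper_cball_fin| |exact: leb_upper_cball_le].
    by rewrite ge0_fin_numE//; exact: leb_eball_lty.
  by rewrite !(mul0r, mulr0).
rewrite -(hs n0) -[n%:R * _ * _]mulrA -(fine_leb_eball hleb x sn) mulrCA.
by congr (_ * _); rewrite divfK.
Unshelve. all: by end_near. Qed.

(** The integral exceeds [p x] times the volume by at most [eps] times the ball volume; multiplied
    by [n], this error is at most [eps * (t * vol_ball leb)]. *)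
Lemma cvg_integral_upper_cball :
  n%:R * fine (\int[leb]_(y in upper_cball (s n)) (p y)%:E) @[n --> \oo] -->
  p x * tau * vol_ball leb * t.
Proof.
set m := fun n => n%:R * fine (leb (upper_cball (s n))).
rewrite (_ : _ * t = p x * (tau * (t * vol_ball leb))); last by ring.
pose q n := n%:R * fine (\int[leb]_(y in upper_cball (s n)) (p y)%:E).
suff qm : q n - p x * m n @[n --> \oo] --> 0.
  have pm : p x * m n @[n --> \oo] --> p x * (tau * (t * vol_ball leb)).
    by apply: cvgMr; exact: cvg_leb_upper_cball.
  rewrite -[X in _ --> X]add0r; apply: (cvg_trans _ (cvgD qm pm)).
  by apply: near_eq_cvg; apply: nearW => n; exact: subrK.
have v0 : 0 <= vol_ball leb by rewrite fine_ge0.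
apply/cvgr0Pnorm_le => e e0.
(* Chosen so that [eps * (t * vol_ball leb) <= e]; the added 1 keeps the denominator positive. *)
pose eps := e / (t * vol_ball leb + 1).
have tv1 : 0 < t * vol_ball leb + 1 by rewrite ltr_wpDl// mulr_ge0// ltW.
have eps0 : 0 < eps by rewrite divr_gt0.
near=> n.
have n0 : (0 < n)%N by near: n; exact: nbhs_infty_gt.
have sn := s0 n0.
have m_fin := leb_upper_cball_fin sn.
have lo := integral_upper_cball_ge (s n).
have hi : (\int[leb]_(y in upper_cball (s n)) (p y)%:E <=
    (p x + eps)%:E * leb (upper_cball (s n)))%E.
  near: n; exact: (cvg_radius (integral_upper_cball_le eps0)).
have q_fin : (\int[leb]_(y in upper_cball (s n)) (p y)%:E)%E \is a fin_num.
  rewrite ge0_fin_numE.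
    by apply: le_lt_trans hi _; rewrite -(fineK m_fin) -EFinM ltry.
  by apply: le_trans lo; rewrite mule_ge0.
move: lo hi; rewrite -(fineK q_fin) -(fineK m_fin) -!EFinM !lee_fin => lo hi.
rewrite /q /m mulrCA -mulrBr ger0_norm ?mulr_ge0 ?subr_ge0//.
have mb : fine (leb (upper_cball (s n))) <= s n ^+ d * vol_ball leb.
  rewrite -(fine_leb_eball hleb x sn); apply: fine_le => //.
    by rewrite ge0_fin_numE//; exact: leb_eball_lty.
  exact: leb_upper_cball_le.
apply: (@le_trans _ _ (n%:R * (eps * (s n ^+ d * vol_ball leb)))).
  rewrite ler_pM2l ?ltr0n//; apply: (@le_trans _ _ (eps * fine (leb (upper_cball (s n))))).
    by rewrite lerBlDr addrC -mulrDl.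
  by rewrite ler_pM2l.
rewrite mulrCA [X in eps * X]mulrA hs// /eps mulrAC.
by rewrite ler_pdivrMr// ler_pM2l// lerDl.
Unshelve. all: by end_near. Qed.

End MassAboveLevel.

(** * Exponential limit away from the modes, divergence at a mode *)

Theorem theorem3 (R : realType) (d : nat)
  (hd : (0 < d)%N)
  (dT : measure_display) (T : measurableType dT) (P : probability T R)
  (leb : {measure set (Rd R d) -> \bar R}) (hleb : is_lebesgue leb)
  (p : 'rV[R]_d -> R) (C : set 'rV[R]_d) (X : nat -> T -> Rd R d)
  (tau L : R) (x : 'rV[R]_d)
  (* X_1, X_2, ... i.i.d. random vectors with density p w.r.t. Lebesgue *)
  (hXmeas : forall i, measurable_fun setT (X i))
  (hind : mutually_independent P X)
  (hpmeas : measurable_fun setT (p : Rd R d -> R))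
  (hdens : forall i (B : set (Rd R d)), measurable B ->
     P (X i @^-1` B) = (\int[leb]_(y in B) (p y)%:E)%E)
  (* (A1) *)
  (hCcpt : compact C)
  (hsupp : forall y, ~ C y -> p y = 0)
  (hpcont : {within C, continuous p})
  (hpbnd : exists M : R, forall y, `|p y| <= M)
  (hpa : exists a : R, 0 < a /\ forall y, C y -> a <= p y)
  (* (A2) *)
  (hA2 : C3_bounded_on p (interior C))
  (* (A3) *)
  (hA3 : morse_on p (interior C))
  (* (A4') *)
  (htau : 0 < tau < 1)
  (hA4 : forall z, C z -> ~ is_mode p z ->
     (fun t : R => fine (leb (upper_set p z `&` eball z t : set (Rd R d)))
                   / fine (leb (eball z t : set (Rd R d)))) @ 0^'+ --> tau)
  (hL : 0 < L)
  (hx : C x) :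
  (~ is_mode p x ->
     cvg_in_distribution P (fun n w => n%:R * delta p L X n x w ^+ d)
       (exponential_prob (p x * tau * vol_ball leb))) /\
  (is_mode p x -> forall w : T,
     (fun n : nat => n%:R * delta p L X n x w ^+ d) @ \oo --> +oo).
Proof.
have [a [a0 pa]] := hpa.
have px0 : 0 <= p x by rewrite ltW// (lt_le_trans a0)// pa.
have v0 : 0 <= vol_ball leb by rewrite fine_ge0.
split=> [nmode t mut|mode w]; last first.
  have [r r0 hr] := nbhs_eball mode.
  (* A lower bound for [delta] valid for every sample: [r] when a higher point exists, [L] for the
     default value. *)
  set m := Num.min r L.
  have m0 : 0 < m by rewrite lt_min r0.
  apply/cvgryPge => A; near=> n.
  apply: (@le_trans _ _ (n%:R * m ^+ d)).
    rewrite -ler_pdivrMr ?exprn_gt0//; near: n; exact: nbhs_infty_ger.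
  apply: ler_wpM2l => //; rewrite lerXn2r ?nnegrE ?(ltW m0)//.
    by rewrite ltW// delta_gt0.
  apply: (@delta_ge _ _ _ _ _ _ _ _ _ r) => // y yr pxy.
  have yx : y != x by apply: contraTneq pxy => ->; rewrite ltxx.
  by have := hr y yr yx; rewrite ltNge (ltW pxy).
have rate0 : 0 <= p x * tau * vol_ball leb.
  by rewrite !mulr_ge0//; case/andP: htau => /ltW.
(* For [t <= 0] the event is empty as soon as [n > 0], since [delta] is positive; at [n = 0] the
   rescaled variable is 0. *)
have [t0|t0] := leP t 0.
  rewrite exponential_prob_Nyc_le0//.
  apply: cvg_near_cst; near=> n.
  rewrite (_ : [set w | _] = set0) ?measure0//.
  rewrite -subset0 => w /=; apply/negP; rewrite -ltNge (le_lt_trans t0)//.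
  rewrite mulr_gt0 ?exprn_gt0 ?delta_gt0// ltr0n.
  by near: n; exact: nbhs_infty_gt.
pose s n := (t / n%:R) `^ d%:R^-1.
have s0 n : (0 < n)%N -> 0 < s n.
  by move=> n0; apply: powR_gt0; rewrite divr_gt0// ltr0n.
have hs n : (0 < n)%N -> n%:R * s n ^+ d = t.
  move=> n0; rewrite -powR_mulrn ?powR_ge0// -powRrM mulVf ?pnatr_eq0 -?lt0n//.
  by rewrite powRr1 ?divr_ge0 ?(ltW t0)// mulrC divfK// pnatr_eq0 -lt0n.
pose Q n := fine (\int[leb]_(y in upper_cball p x (s n)) (p y)%:E).
have mA n : measurable (upper_cball p x (s n)) by exact: measurable_upper_cball.
have hQ n i : P (X i @^-1` upper_cball p x (s n)) = (Q n)%:E.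
  (* The integral is a probability, hence finite, so [fine] loses nothing. *)
  rewrite fineK -?(hdens i)// fin_num_measure// -[X in measurable X]setTI.
  exact: hXmeas.
have Q0 n : 0 <= Q n by rewrite -lee_fin -(hQ n 0) measure_ge0.
rewrite exponential_prob_Nyc// mulNr.
have nQ := cvg_integral_upper_cball hleb hpmeas hsupp hpcont hx px0 hd (hA4 _ hx nmode) t0 s0 hs.
have lim : 1 - (1 - Q n) ^+ n @[n --> \oo] --> 1 - expR (- (p x * tau * vol_ball leb * t)).
  exact: (cvgB (cvg_cst (1 : R)) (cvg_exp1B Q0 nQ)).
apply: (@cvg_trans _ ((1 - (1 - Q n) ^+ n)%:E @[n --> \oo])); last first.
  by apply: cvg_EFin; [exact: nearW|exact: lim].
apply: near_eq_cvg; near=> n.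
have n0 : (0 < n)%N by near: n; exact: nbhs_infty_gt.
(* Once the radius is below [L], the default value of [delta] lies outside the event, which then
   says exactly that some sample point hits the upper ball. *)
have sL : s n < L.
  near: n; exact: (cvg_radius hd s0 hs (nbhs_right_lt hL)).
rewrite -(prob_some_in hXmeas hind n (mA n) (hQ n)).
congr (P _); apply/seteqP; split => w /=.
  by move=> [i [pi xi]]; rewrite natM_delta_le// ?(ltW t0)//; apply/delta_leP => //; exists i.
rewrite natM_delta_le// ?(ltW t0)// => /(delta_leP _ _ _ _ _ sL)[i pi xi].
by exists i; split.
Unshelve. all: by end_near. Qed.
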